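(* Let $\mathsf{C}$ be a category and $F:\mathsf{C}\to\mathsf{C}$ an endofunctor. Assume that every $F$-algebra $a$ has a relatively terminal coalgebra $\nu(a)$, and every $F$-coalgebra $b$ has a relatively initial algebra $\mu(b)$. Then the assignments $a\mapsto\nu(a)$ and $b\mapsto\mu(b)$ are the object parts of two functors $\nu:\mathsf{Alg}_F\to\mathsf{Coalg}_F$ and $\mu:\mathsf{Coalg}_F\to\mathsf{Alg}_F$, and these are adjoint: $\mu\dashv\nu$ (with $\mu$ left adjoint to $\nu$).
   Context: $\mathsf{Alg}_F$ and $\mathsf{Coalg}_F$ denote the categories of $F$-algebras $a:FA\to A$ and $F$-coalgebras $b:B\to FB$ with their usual morphisms. For a coalgebra $b:B\to FB$ and an algebra $a:FA\to A$, a coalgebra-to-algebra morphism (ca-morphism) from $b$ to $a$ is a morphism $f:B\to A$ with $f=a\circ Ff\circ b$. The set of these is denoted $\mathsf{CA}_F(b,a)$; precomposition with coalgebra morphisms and postcomposition with algebra morphisms make $\mathsf{CA}_F$ a functor $\mathsf{Coalg}_F^{\mathrm{op}}\times\mathsf{Alg}_F\to\mathsf{Set}$. A coalgebra $c$ is terminal relative to an algebra $a$ (a relatively terminal coalgebra of $a$) if there is a natural isomorphism $\phi:\mathsf{Coalg}_F(-,c)\cong\mathsf{CA}_F(-,a)$; such a coalgebra is unique up to unique isomorphism and denoted $\nu(a)$. An algebra $d$ is initial relative to a coalgebra $b$ (a relatively initial algebra of $b$) if there is a natural isomorphism $\psi:\mathsf{Alg}_F(d,-)\cong\mathsf{CA}_F(b,-)$;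 such an algebra is unique up to unique isomorphism and denoted $\mu(b)$. *)

(* Defs.v *)
From Stdlib Require Import FunctionalExtensionality ProofIrrelevance.

Set Implicit Arguments.
Unset Strict Implicit.
Unset Printing Implicit Defensive.

Local Obligation Tactic := cbn; intros.

(** The hom-types of every [Category] live in a universe contained in that of
    the objects of [SetCat], so categories are locally small relative to
    [SetCat]; the type of objects may be large. *)

Record Category := {
  Obj :> Type;
  Hom : Obj -> Obj -> Type;
  idm : forall x, Hom x x;
  compose : forall x y z, Hom y z -> Hom x y -> Hom x z;
  compose_id_l : forall x y (f : Hom x y), compose (idm y) f = f;
  compose_id_r : forall x y (f : Hom x y), compose f (idm x) = f;
  compose_assoc : forall w x y z (h : Hom y z) (g : Hom x y) (f : Hom w x),
    compose h (compose g f) = compose (compose h g) f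
}.

Arguments Hom {_} _ _.
Arguments idm {_} _.
Arguments compose {_} {_ _ _} _ _.

Declare Scope cat_scope.
Delimit Scope cat_scope with cat.
Open Scope cat_scope.
Notation "g ∘ f" := (compose g f) (at level 40, left associativity) : cat_scope.

Record Functor (C D : Category) := {
  fobj :> C -> D;
  fmap : forall x y : C, Hom x y -> Hom (fobj x) (fobj y);
  fmap_id : forall x : C, fmap (idm x) = idm (fobj x);
  fmap_comp : forall (x y z : C) (g : Hom y z) (f : Hom x y),
    fmap (g ∘ f) = fmap g ∘ fmap f
}.

Arguments fmap {_ _} _ {_ _} _.

Record NatTrans (C D : Category) (G H : Functor C D) := {
  component :> forall x : C, Hom (G x) (H x);
  naturality : forall (x y : C) (f : Hom x y),
    component y ∘ fmap G f = fmap H f ∘ component x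
}.

Definition is_iso (C : Category) (x y : C) (f : Hom x y) : Prop :=
  exists g : Hom y x, g ∘ f = idm x /\ f ∘ g = idm y.

Definition naturally_isomorphic (C D : Category) (G H : Functor C D) : Prop :=
  exists phi : NatTrans G H, forall x : C, is_iso (phi x).

Notation "G ≅ H" := (naturally_isomorphic G H) (at level 70) : cat_scope.

Definition SetCat : Category := {|
  Obj := Type;
  Hom := fun X Y => X -> Y;
  idm := fun X x => x;
  compose := fun X Y Z g f x => g (f x);
  compose_id_l := fun X Y f => eq_refl;
  compose_id_r := fun X Y f => eq_refl;
  compose_assoc := fun W X Y Z h g f => eq_refl
|}.

Definition op (C : Category) : Category := {|
  Obj := C;
  Hom := fun x y => @Hom C y x;
  idm := fun x => @idm C x;
  compose := fun x y z g f => @compose C z y x f g;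
  compose_id_l := fun x y f => compose_id_r f;
  compose_id_r := fun x y f => compose_id_l f;
  compose_assoc := fun w x y z h g f => eq_sym (compose_assoc f g h)
|}.

Program Definition prod_cat (C D : Category) : Category := {|
  Obj := (C * D)%type;
  Hom := fun p q => (Hom (fst p) (fst q) * Hom (snd p) (snd q))%type;
  idm := fun p => (idm (fst p), idm (snd p));
  compose := fun p q r g f => (fst g ∘ fst f, snd g ∘ snd f)
|}.
Next Obligation. now destruct f; cbn; rewrite !compose_id_l. Qed.
Next Obligation. now destruct f; cbn; rewrite !compose_id_r. Qed.
Next Obligation. now rewrite !compose_assoc. Qed.

Definition id_functor (C : Category) : Functor C C := {|
  fobj := fun x => x;
  fmap := fun x y f => f;
  fmap_id := fun x => eq_refl;
  fmap_comp := fun x y z g f => eq_refl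
|}.

Program Definition comp_functor (C D E : Category)
    (G : Functor D E) (H : Functor C D) : Functor C E := {|
  fobj := fun x => G (H x);
  fmap := fun x y f => fmap G (fmap H f)
|}.
Next Obligation. now rewrite !fmap_id. Qed.
Next Obligation. now rewrite !fmap_comp. Qed.

Definition op_functor (C D : Category) (G : Functor C D) :
    Functor (op C) (op D) := {|
  fobj := (fun x => G x) : op C -> op D;
  fmap := fun x y f => @fmap C D G y x f;
  fmap_id := fun x => @fmap_id C D G x;
  fmap_comp := fun x y z g f => @fmap_comp C D G z y x f g
|}.

Program Definition prod_functor (C C' D D' : Category)
    (G : Functor C C') (H : Functor D D') :
    Functor (prod_cat C D) (prod_cat C' D') := {|
  fobj := (fun p => (G (fst p), H (snd p))) : prod_cat C D -> prod_cat C' D';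
  fmap := fun p q f => (fmap G (fst f), fmap H (snd f))
|}.
Next Obligation. now rewrite !fmap_id. Qed.
Next Obligation. now rewrite !fmap_comp. Qed.

(** [G(x, -)] and [G(-, y)] for a bifunctor [G]. *)
Program Definition fix_left (C D E : Category)
    (G : Functor (prod_cat C D) E) (x : C) : Functor D E := {|
  fobj := fun y => G (x, y);
  fmap := fun y y' g => @fmap _ _ G (x, y) (x, y') (idm x, g)
|}.
Next Obligation. exact (@fmap_id _ _ G (x, _)). Qed.
Next Obligation.
rewrite <- fmap_comp; cbn; now rewrite compose_id_l.
Qed.

Program Definition fix_right (C D E : Category)
    (G : Functor (prod_cat C D) E) (y : D) : Functor C E := {|
  fobj := fun x => G (x, y);
  fmap := fun x x' f => @fmap _ _ G (x, y) (x', y) (f, idm y)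
|}.
Next Obligation. exact (@fmap_id _ _ G (x, y)). Qed.
Next Obligation.
rewrite <- fmap_comp; cbn; now rewrite compose_id_l.
Qed.

Program Definition hom_functor (C : Category) :
    Functor (prod_cat (op C) C) SetCat := {|
  fobj := (fun p => @Hom C (fst p) (snd p)) : prod_cat (op C) C -> SetCat;
  fmap := fun p q f h => snd f ∘ h ∘ (fst f : @Hom C (fst q) (fst p))
|}.
Next Obligation.
apply functional_extensionality; intro h; cbn.
now rewrite compose_id_l, compose_id_r.
Qed.
Next Obligation.
apply functional_extensionality; intro h; cbn.
now rewrite !compose_assoc.
Qed.

(** Natural isomorphism of [D(L -, -)] and [C(-, R -)] on [op C × D]. *)
Definition adjoint (C D : Category) (L : Functor C D) (R : Functor D C) : Prop :=
  comp_functor (hom_functor D) (prod_functor (op_functor L) (id_functor D))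
  ≅ comp_functor (hom_functor C) (prod_functor (id_functor (op C)) R).

Notation "L ⊣ R" := (adjoint L R) (at level 70) : cat_scope.

Lemma sig_eq (A : Type) (P : A -> Prop) (u v : {x : A | P x}) :
  proj1_sig u = proj1_sig v -> u = v.
Proof. apply eq_sig_hprop; intros; apply proof_irrelevance. Qed.

Section Algebras.
Variables (C : Category) (F : Functor C C).

Record algebra := { alg_car : C; alg_str : Hom (F alg_car) alg_car }.

Record coalgebra := { coalg_car : C; coalg_str : Hom coalg_car (F coalg_car) }.

Definition alg_hom (a a' : algebra) :=
  { f : Hom (alg_car a) (alg_car a') |
    f ∘ alg_str a = alg_str a' ∘ fmap F f }.

Definition coalg_hom (b b' : coalgebra) :=
  { f : Hom (coalg_car b) (coalg_car b') |
    coalg_str b' ∘ f = fmap F f ∘ coalg_str b }.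

Definition ca_hom (b : coalgebra) (a : algebra) :=
  { f : Hom (coalg_car b) (alg_car a) |
    f = alg_str a ∘ fmap F f ∘ coalg_str b }.

Program Definition Alg : Category := {|
  Obj := algebra;
  Hom := alg_hom;
  idm := fun a => exist _ (idm (alg_car a)) _;
  compose := fun a a' a'' g f => exist _ (proj1_sig g ∘ proj1_sig f) _
|}.
Next Obligation. now rewrite fmap_id, compose_id_l, compose_id_r. Qed.
Next Obligation.
destruct g as [g Hg], f as [f Hf]; cbn.
now rewrite <- compose_assoc, Hf, compose_assoc, Hg, fmap_comp, compose_assoc.
Qed.
Next Obligation. apply sig_eq; apply compose_id_l. Qed.
Next Obligation. apply sig_eq; apply compose_id_r. Qed.
Next Obligation. apply sig_eq; apply compose_assoc. Qed.

Program Definition Coalg : Category := {|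
  Obj := coalgebra;
  Hom := coalg_hom;
  idm := fun b => exist _ (idm (coalg_car b)) _;
  compose := fun b b' b'' g f => exist _ (proj1_sig g ∘ proj1_sig f) _
|}.
Next Obligation. now rewrite fmap_id, compose_id_l, compose_id_r. Qed.
Next Obligation.
destruct g as [g Hg], f as [f Hf]; cbn.
now rewrite compose_assoc, Hg, <- compose_assoc, Hf, fmap_comp, compose_assoc.
Qed.
Next Obligation. apply sig_eq; apply compose_id_l. Qed.
Next Obligation. apply sig_eq; apply compose_id_r. Qed.
Next Obligation. apply sig_eq; apply compose_assoc. Qed.

Lemma ca_hom_compose (b b' : coalgebra) (a a' : algebra)
    (g : alg_hom a a') (h : ca_hom b a) (f : coalg_hom b' b) :
  let k := proj1_sig g ∘ proj1_sig h ∘ proj1_sig f in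
  k = alg_str a' ∘ fmap F k ∘ coalg_str b'.
Proof.
destruct g as [g Hg], h as [h Hh], f as [f Hf]; cbn.
transitivity (g ∘ (alg_str a ∘ fmap F h ∘ coalg_str b) ∘ f).
{ now rewrite <- Hh. }
rewrite !fmap_comp, <- !compose_assoc, Hf, !compose_assoc, Hg.
reflexivity.
Qed.

Program Definition CA : Functor (prod_cat (op Coalg) Alg) SetCat := {|
  fobj := (fun p => ca_hom (fst p) (snd p)) : prod_cat (op Coalg) Alg -> SetCat;
  fmap := fun p q gf h => exist _ _ (ca_hom_compose (snd gf) h (fst gf))
|}.
Next Obligation.
apply functional_extensionality; intro h; apply sig_eq; cbn.
now rewrite compose_id_l, compose_id_r.
Qed.
Next Obligation.
apply functional_extensionality; intro h; apply sig_eq; cbn.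
now rewrite !compose_assoc.
Qed.

Definition relatively_terminal (a : Alg) (c : Coalg) : Prop :=
  fix_right (hom_functor Coalg) c ≅ fix_right CA a.

Definition relatively_initial (b : Coalg) (d : Alg) : Prop :=
  fix_left (hom_functor Alg) d ≅ fix_left CA b.

End Algebras.

(* Main.v *)
(** Let [φ_d : C(-, R d) ≅ G(-, d)] represent each functor [G(-, d)] of a bifunctor
    [G : C^op × D -> Set].  By the Yoneda lemma [R] becomes a functor in exactly
    one way making [φ] natural in [d] as well: [R g] is the morphism sent by
    [φ_d'] to [G(id, g) (φ_d id)].  Applying this and its dual to [CA] yields
    [Alg(μ b, a) ≅ CA(b, a) ≅ Coalg(b, ν a)], naturally in [a] and [b]. *)

From Stdlib Require Import FunctionalExtensionality ClassicalEpsilon.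
Require Import Defs.

Set Implicit Arguments.
Unset Strict Implicit.
Unset Printing Implicit Defensive.

(** Inverses of the components are again natural. Since [is_iso] only asserts that they exist,
    choice selects a family of them. *)
Lemma nat_iso_sym (C D : Category) (G H : Functor C D) : G ≅ H -> H ≅ G.
Proof.
intros [phi Hphi].
pose (psi x := proj1_sig (constructive_indefinite_description _ (Hphi x))).
assert (Hpsi : forall x, psi x ∘ phi x = idm _ /\ phi x ∘ psi x = idm _).
{ intro x; exact (proj2_sig (constructive_indefinite_description _ (Hphi x))). }
unshelve eexists (Build_NatTrans (component := psi) _).
- intros x y f.
  (* Insert [phi x ∘ psi x] on the right, move [phi] across by naturality, and cancel
     [psi y ∘ phi y]. *)
  rewrite <- (compose_id_r (psi y ∘ fmap H f)), <- (proj2 (Hpsi x)).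
  rewrite compose_assoc, <- (compose_assoc (psi y)), <- naturality.
  now rewrite (compose_assoc (psi y)), (proj1 (Hpsi y)), compose_id_l.
- intro x; exists (phi x); split; apply Hpsi.
Qed.

Lemma nat_iso_trans (C D : Category) (G H K : Functor C D) :
  G ≅ H -> H ≅ K -> G ≅ K.
Proof.
intros [phi Hphi] [psi Hpsi].
unshelve eexists (Build_NatTrans (component := fun x => psi x ∘ phi x) _).
- intros x y f.
  cbn; rewrite <- compose_assoc, naturality, compose_assoc, naturality.
  now rewrite compose_assoc.
- intro x; destruct (Hphi x) as [f [Hf1 Hf2]], (Hpsi x) as [g [Hg1 Hg2]].
  exists (f ∘ g); cbn; split.
  + rewrite <- compose_assoc, (compose_assoc g), Hg1, compose_id_l; exact Hf1.
  + rewrite <- compose_assoc, (compose_assoc (phi x)), Hf2, compose_id_l.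
    exact Hg2.
Qed.

Lemma fmap_comp_app (C : Category) (G : Functor C SetCat) (x y z : C)
    (g : Hom y z) (f : Hom x y) (u : G x) :
  fmap G g (fmap G f u) = fmap G (g ∘ f) u.
Proof. now rewrite fmap_comp. Qed.

Lemma naturality_app (C : Category) (G H : Functor C SetCat)
    (phi : NatTrans G H) (x y : C) (f : Hom x y) (u : G x) :
  phi y (fmap G f u) = fmap H f (phi x u).
Proof. exact (f_equal (fun k => k u) (naturality phi f)). Qed.

Lemma iso_injective (X Y : SetCat) (f : Hom X Y) (u v : X) :
  is_iso f -> f u = f v -> u = v.
Proof.
intros [g [Hg _]] E.
assert (K : forall w, g (f w) = w) by (intro w; exact (f_equal (fun k => k w) Hg)).
now rewrite <- (K u), E, K.
Qed.

Lemma iso_surjective (X Y : SetCat) (f : Hom X Y) (v : Y) :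
  is_iso f -> exists u : X, f u = v.
Proof.
intros [g [_ Hg]]; exists (g v); exact (f_equal (fun k => k v) Hg).
Qed.

Lemma right_representing_functor (C D : Category)
    (G : Functor (prod_cat (op C) D) SetCat) (R0 : D -> C)
    (HR : forall d : D, fix_right (hom_functor C) (R0 d) ≅ fix_right G d) :
  exists R : Functor D C, (forall d : D, R d = R0 d) /\
    comp_functor (hom_functor C) (prod_functor (id_functor (op C)) R) ≅ G.
Proof.
(* The isomorphisms are chosen independently for each [d]; naturality in [d] is imposed later by the
   action of [R] on morphisms. *)
pose (phi d := proj1_sig (constructive_indefinite_description _ (HR d))).
assert (Hphi : forall d c, is_iso (phi d c)).
{ intro d; exact (proj2_sig (constructive_indefinite_description _ (HR d))). }
clearbody phi.
assert (Hpre : forall d (c c' : C) (f : Hom c' c) (u : Hom c (R0 d)),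
  phi d c' (u ∘ f) = @fmap _ _ G (c, d) (c', d) (f, idm d) (phi d c u)).
{ intros d c c' f u.
  (* The fixed-variable hom functor also composes with an identity, which must be inserted before
     naturality applies. *)
  transitivity (phi d c' (idm (R0 d) ∘ u ∘ f)).
  - now rewrite compose_id_l.
  - exact (@naturality_app _ _ _ (phi d) c c' f u). }
assert (Hex : forall d d' (g : Hom d d'), exists r : Hom (R0 d) (R0 d'),
  phi d' (R0 d) r =
  @fmap _ _ G (R0 d, d) (R0 d, d') (idm (R0 d), g) (phi d (R0 d) (idm _))).
{ intros; apply iso_surjective, Hphi. }
pose (R1 d d' g :=
  proj1_sig (constructive_indefinite_description _ (Hex d d' g))).
(* The defining equation at [idm] extends to every [u]: by [Hpre], both sides equal [G] at [(u, g)]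
   applied to the universal element [phi d (R0 d) (idm _)]. *)
assert (HR1 : forall d d' (g : Hom d d') (c : C) (u : Hom c (R0 d)),
  phi d' c (R1 d d' g ∘ u) =
  @fmap _ _ G (c, d) (c, d') (idm c, g) (phi d c u)).
{ intros d d' g c u.
  rewrite Hpre.
  unfold R1; destruct constructive_indefinite_description as [r Hr]; cbn.
  rewrite Hr; rewrite <- (compose_id_l u) at 2.
  rewrite Hpre, !fmap_comp_app; cbn.
  now rewrite !compose_id_l, !compose_id_r. }
clearbody R1.
unshelve eexists {| fobj := R0; fmap := R1 |}.
(* Both functor laws are checked after applying the injective [phi], where [HR1] reduces them to the
   functor laws of [G]. *)
- intro d; apply (iso_injective (Hphi d (R0 d))).
  rewrite <- (compose_id_r (R1 _ _ _)), HR1.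
  exact (f_equal (fun k => k _) (@fmap_id _ _ G (R0 d, d))).
- intros x y z g f; apply (iso_injective (Hphi z (R0 x))).
  rewrite HR1, <- (compose_id_r (R1 _ _ (g ∘ f))), HR1.
  rewrite <- (compose_id_r (R1 _ _ f)), HR1, fmap_comp_app; cbn.
  now rewrite compose_id_l.
- split; [reflexivity|].
  unshelve eexists (Build_NatTrans (component := _) _).
  + intros [c d]; exact (phi d c).
  (* Joint naturality splits into [HR1] for [g] and [Hpre] for [f]. *)
  + intros [c d] [c' d'] [f g]; apply functional_extensionality; intro u.
    cbn in *; rewrite <- compose_assoc, HR1, Hpre, fmap_comp_app; cbn.
    now rewrite !compose_id_r.
  + intros [c d]; apply Hphi.
Qed.

(** Dual of the previous lemma, argued directly: deducing it by passing to opposites would require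
    swapping the factors of the product category. *)
Lemma left_representing_functor (C D : Category)
    (G : Functor (prod_cat (op C) D) SetCat) (L0 : C -> D)
    (HL : forall c : C, fix_left (hom_functor D) (L0 c) ≅ fix_left G c) :
  exists L : Functor C D, (forall c : C, L c = L0 c) /\
    comp_functor (hom_functor D) (prod_functor (op_functor L) (id_functor D))
    ≅ G.
Proof.
pose (phi c := proj1_sig (constructive_indefinite_description _ (HL c))).
assert (Hphi : forall c d, is_iso (phi c d)).
{ intro c; exact (proj2_sig (constructive_indefinite_description _ (HL c))). }
clearbody phi.
assert (Hpost : forall c (d d' : D) (g : Hom d d') (u : Hom (L0 c) d),
  phi c d' (g ∘ u) = @fmap _ _ G (c, d) (c, d') (idm c, g) (phi c d u)).
{ intros c d d' g u.
  transitivity (phi c d' (g ∘ u ∘ idm (L0 c))).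
  - now rewrite compose_id_r.
  - exact (@naturality_app _ _ _ (phi c) d d' g u). }
(* [G] is contravariant in its first argument, so [f] carries the universal element of [c'] to one
   over [c], and [l] represents it; hence [L] is covariant. *)
assert (Hex : forall c c' (f : Hom c c'), exists l : Hom (L0 c) (L0 c'),
  phi c (L0 c') l =
  @fmap _ _ G (c', L0 c') (c, L0 c') (f, idm (L0 c')) (phi c' (L0 c') (idm _))).
{ intros; apply iso_surjective, Hphi. }
pose (L1 c c' f :=
  proj1_sig (constructive_indefinite_description _ (Hex c c' f))).
assert (HL1 : forall c c' (f : Hom c c') (d : D) (u : Hom (L0 c') d),
  phi c d (u ∘ L1 c c' f) =
  @fmap _ _ G (c', d) (c, d) (f, idm d) (phi c' d u)).
{ intros c c' f d u.
  rewrite Hpost.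
  unfold L1; destruct constructive_indefinite_description as [l Hl]; cbn.
  rewrite Hl; rewrite <- (compose_id_r u) at 2.
  rewrite Hpost, !fmap_comp_app; cbn.
  now rewrite !compose_id_l, !compose_id_r. }
clearbody L1.
unshelve eexists {| fobj := L0; fmap := L1 |}.
- intro c; apply (iso_injective (Hphi c (L0 c))).
  rewrite <- (compose_id_l (L1 _ _ _)), HL1.
  exact (f_equal (fun k => k _) (@fmap_id _ _ G (c, L0 c))).
- intros x y z g f; apply (iso_injective (Hphi x (L0 z))).
  rewrite HL1, <- (compose_id_l (L1 _ _ (g ∘ f))), HL1.
  rewrite <- (compose_id_l (L1 _ _ g)), HL1, fmap_comp_app; cbn.
  now rewrite compose_id_l.
- split; [reflexivity|].
  unshelve eexists (Build_NatTrans (component := _) _).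
  + intros [c d]; exact (phi c d).
  + intros [c d] [c' d'] [f g]; apply functional_extensionality; intro u.
    cbn in *; rewrite HL1, Hpost, fmap_comp_app; cbn.
    now rewrite !compose_id_l.
  + intros [c d]; apply Hphi.
Qed.

Theorem theorem2p5 (C : Category) (F : Functor C C)
    (nu0 : Alg F -> Coalg F) (mu0 : Coalg F -> Alg F)
    (Hnu : forall a : Alg F, relatively_terminal a (nu0 a))
    (Hmu : forall b : Coalg F, relatively_initial b (mu0 b)) :
  exists (nu : Functor (Alg F) (Coalg F)) (mu : Functor (Coalg F) (Alg F)),
    (forall a : Alg F, nu a = nu0 a) /\
    (forall b : Coalg F, mu b = mu0 b) /\
    mu ⊣ nu.
Proof.
destruct (right_representing_functor Hnu) as [nu [Hnu0 Hnu1]].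
destruct (left_representing_functor Hmu) as [mu [Hmu0 Hmu1]].
exists nu, mu; repeat split; trivial.
(* Both hom bifunctors are isomorphic to [CA F], which links them. *)
exact (nat_iso_trans Hmu1 (nat_iso_sym Hnu1)).
Qed.
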